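(* Let $n\ge2$ and let $B_1=B_1(0)\subset\mathbb{R}^n$ be the open unit ball. There exist sequences of functions $u_k\in\mathcal{C}(\overline{B_1})$ and $f_k\in\mathcal{C}(B_1)$ such that $u_k$ is a viscosity solution of $-\Delta_\infty^N u_k=f_k$ in $B_1$, $u_k=0$ on $\partial B_1$, $$\sup_{B_1}u_k\to1\quad\text{and}\quad \|f_k\|_{L^n(B_1)}\to0\qquad\text{as }k\to\infty .$$ Consequently the classical Alexandrov-Bakelman-Pucci estimate fails for the normalized infinity Laplacian: there is no constant $C$ such that $$\sup_{B_1}u\le\sup_{\partial B_1}u+C\,\|f\|_{L^n(B_1)}$$ for all $u\in\mathcal{C}(\overline{B_1})$ and $f\in\mathcal{C}(B_1)$ for which $u$ is a viscosity solution of $-\Delta_\infty^N u=f$ in $B_1$.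
   Context: For a symmetric matrix $X$, $M(X)$ and $m(X)$ are its greatest and smallest eigenvalues. The normalized infinity Laplacian is $\Delta_\infty^N\varphi=\big\langle D^2\varphi\,\frac{\nabla\varphi}{|\nabla\varphi|},\frac{\nabla\varphi}{|\nabla\varphi|}\big\rangle$ where $\nabla\varphi\ne0$. A continuous $u:\Omega\to\mathbb{R}$ is a viscosity solution of $-\Delta_\infty^N u=f$ in an open set $\Omega$ if: for all $x_0\in\Omega$ and $\varphi\in\mathcal{C}^2(\Omega)$ such that $u-\varphi$ has a local maximum at $x_0$, one has $-\Delta_\infty^N\varphi(x_0)\le f(x_0)$ if $\nabla\varphi(x_0)\neq0$, and $-M(D^2\varphi(x_0))\le f(x_0)$ if $\nabla\varphi(x_0)=0$; and for all $x_0\in\Omega$ and $\varphi\in\mathcal{C}^2(\Omega)$ such that $u-\varphi$ has a local minimum at $x_0$, one has $-\Delta_\infty^N\varphi(x_0)\ge f(x_0)$ if $\nabla\varphi(x_0)\ne0$, and $-m(D^2\varphi(x_0))\ge f(x_0)$ if $\nabla\varphi(x_0)=0$. *)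

(* Defs.v *)
From HB Require Import structures.
From mathcomp Require Import all_boot all_order all_algebra.
From mathcomp Require Import all_classical all_reals all_analysis.
Import Order.TTheory GRing.Theory Num.Theory.
Import numFieldNormedType.Exports.

Set Implicit Arguments.
Unset Strict Implicit.
Unset Printing Implicit Defensive.

Local Open Scope classical_set_scope.
Local Open Scope ring_scope.

Section LebesgueTuple.
Variable R : realType.
(* R with its Borel sigma-algebra *)
Local Notation mR := (measurableTypeR R).

Definition tuple_cons n (p : mR * n.-tuple mR) : n.+1.-tuple mR :=
  [tuple of p.1 :: p.2].

Lemma measurable_tuple_cons n :
  measurable_fun [set: mR * n.-tuple mR] (@tuple_cons n).
Proof. exact: measurable_cons. Qed.

(* Lebesgue measure on R^n, with R^n represented by n-tuples and equipped with
   the product sigma-algebra: the n-fold product of the one-dimensional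
   Lebesgue measure, the empty product being the Dirac mass on R^0. *)
Fixpoint lebesgue_tuple (n : nat) : set (n.-tuple mR) -> \bar R :=
  match n with
  | 0 => \d_([tuple] : 0.-tuple mR)
  | m.+1 => pushforward (lebesgue_measure \x @lebesgue_tuple m)%E
              (@tuple_cons m)
  end.
Arguments lebesgue_tuple n A : clear implicits.

Section LebesgueTupleStep.
Variables (n : nat) (mu : {sigma_finite_measure set (n.-tuple mR) -> \bar R}).

Definition lebesgue_step : set (n.+1.-tuple mR) -> \bar R :=
  pushforward (lebesgue_measure \x mu)%E (@tuple_cons n).

Let step0 : lebesgue_step set0 = 0%E.
Proof. by rewrite /lebesgue_step /pushforward preimage_set0 measure0. Qed.

Let step_ge0 A : (0 <= lebesgue_step A)%E.
Proof. by rewrite /lebesgue_step /pushforward measure_ge0. Qed.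

Let step_sigma_additive : semi_sigma_additive lebesgue_step.
Proof.
have mc := @measurable_tuple_cons n.
by have := @measure_semi_sigma_additive _ _ _
  (measure_function_pushforward__canonical__measure_function_Measure
     (lebesgue_measure \x mu)%E mc).
Qed.

HB.instance Definition _ := isMeasure.Build _ _ _
  lebesgue_step step0 step_ge0 step_sigma_additive.

Let step_sigma_finite : sigma_finite setT lebesgue_step.
Proof.
have /sigma_finiteP[F [TF ndF Foo]] :=
  sigma_finiteT (lebesgue_measure : {sigma_finite_measure set mR -> \bar R}).
have /sigma_finiteP[G [TG ndG Goo]] := sigma_finiteT mu.
exists (fun k => [set t | F k (thead t) /\ G k [tuple of behead t]]).
  apply/esym; rewrite -subTset => t _.
  have [i _ Fi] : (\bigcup_i F i) (thead t) by rewrite -TF.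
  have [j _ Gj] : (\bigcup_i G i) [tuple of behead t] by rewrite -TG.
  exists (maxn i j) => //; split.
  - by move: Fi; exact/subsetPset/ndF/leq_maxl.
  - by move: Gj; exact/subsetPset/ndG/leq_maxr.
move=> k; have [mF Fk] := Foo k; have [mG Gk] := Goo k; split.
  apply: measurableI.
    by rewrite -[X in measurable X]setTI; exact: measurable_tnth.
  by rewrite -[X in measurable X]setTI; exact: measurable_behead.
rewrite /lebesgue_step /pushforward (_ : _ @^-1` _ = F k `*` G k).
  by rewrite product_measure1E// lte_mul_pinfty// ge0_fin_numE.
have consK x (t : n.-tuple mR) :
    [tuple of behead (tuple_cons (x, t))] = t by exact/val_inj.
by apply/seteqP; split => -[x t] /= []; rewrite consK.
Qed.

HB.instance Definition _ := Measure_isSigmaFinite.Build _ _ _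
  lebesgue_step step_sigma_finite.

End LebesgueTupleStep.

Lemma lebesgue_tuple_sigma_finite_measure n :
  exists mu : {sigma_finite_measure set (n.-tuple mR) -> \bar R},
    lebesgue_tuple n = mu.
Proof.
elim: n => [|n [mu IH]]; first by exists (\d_([tuple] : 0.-tuple mR)).
by rewrite /= IH; exists (lebesgue_step mu).
Qed.

Section LebesgueTupleMeasure.
Variable n : nat.

Let lebesgue_tuple0 : lebesgue_tuple n set0 = 0%E.
Proof.
by have [mu ->] := lebesgue_tuple_sigma_finite_measure n; exact: measure0.
Qed.

Let lebesgue_tuple_ge0 A : (0 <= lebesgue_tuple n A)%E.
Proof.
by have [mu ->] := lebesgue_tuple_sigma_finite_measure n; exact: measure_ge0.
Qed.

Let lebesgue_tuple_sigma_additive : semi_sigma_additive (lebesgue_tuple n).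
Proof.
have [mu ->] := lebesgue_tuple_sigma_finite_measure n.
exact: measure_semi_sigma_additive.
Qed.

HB.instance Definition _ := isMeasure.Build _ _ _ (lebesgue_tuple n)
  lebesgue_tuple0 lebesgue_tuple_ge0 lebesgue_tuple_sigma_additive.

Let lebesgue_tuple_sigma_finite : sigma_finite setT (lebesgue_tuple n).
Proof.
by have [mu ->] := lebesgue_tuple_sigma_finite_measure n; exact: sigma_finiteT.
Qed.

HB.instance Definition _ := Measure_isSigmaFinite.Build _ _ _
  (lebesgue_tuple n) lebesgue_tuple_sigma_finite.

End LebesgueTupleMeasure.

End LebesgueTuple.
Arguments lebesgue_tuple {R} n A.

Section Euclidean.
Variables (R : realType) (n : nat).

(* The library's norm on 'rV[R]_n is the sup norm; it induces the usual
   topology, but lengths below are Euclidean. *)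
Definition eucl_norm (x : 'rV[R]_n) : R := Num.sqrt (\sum_(i < n) x 0 i ^+ 2).

Definition unit_ball : set 'rV[R]_n := [set x | eucl_norm x < 1].
Definition unit_cball : set 'rV[R]_n := [set x | eucl_norm x <= 1].
Definition unit_sphere : set 'rV[R]_n := [set x | eucl_norm x = 1].

Definition row_of_tuple (t : n.-tuple R) : 'rV[R]_n := \row_i tnth t i.

(* L^p(A) norm, valued in [0, +oo]; f \_ A is f extended by zero outside A. *)
Definition Lp_norm (p : R) (A : set 'rV[R]_n) (f : 'rV[R]_n -> R) : \bar R :=
  'N[lebesgue_tuple n]_p%:E [EFin \o (f \_ A) \o row_of_tuple].

End Euclidean.
Arguments unit_ball R n x : clear implicits.
Arguments unit_cball R n x : clear implicits.
Arguments unit_sphere R n x : clear implicits.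

Section Differential.
Variables (R : realType) (n : nat).
Implicit Types (phi : 'rV[R]_n -> R) (x : 'rV[R]_n) (X : 'M[R]_n).

Definition partial (i : 'I_n) phi : 'rV[R]_n -> R :=
  fun x => 'D_(delta_mx 0 i) phi x.

Definition gradient phi x : 'rV[R]_n := \row_i partial i phi x.

Definition hessian phi x : 'M[R]_n :=
  \matrix_(i, j) partial i (partial j phi) x.

(* phi is of class C^2 on the open set Om: all partial derivatives of order at
   most 2 exist and are continuous at every point of Om. *)
Definition C2_on (Om : set 'rV[R]_n) phi : Prop :=
  forall x, Om x ->
  [/\ {for x, continuous phi},
      forall i, derivable phi x (delta_mx 0 i) /\
        {for x, continuous (partial i phi)}
    & forall i j, derivable (partial j phi) x (delta_mx 0 i) /\
        {for x, continuous (partial i (partial j phi))}].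

(* Greatest and smallest eigenvalue; for n > 0 and X symmetric, the set of real
   eigenvalues is finite and nonempty, so that sup and inf are attained. *)
Definition max_eigenvalue X : R := sup [set a | eigenvalue X a].
Definition min_eigenvalue X : R := inf [set a | eigenvalue X a].

(* Only meaningful where the gradient does not vanish. *)
Definition inf_laplacian phi x : R :=
  let nu := (eucl_norm (gradient phi x))^-1 *: gradient phi x in
  (nu *m hessian phi x *m nu^T) 0 0.

(* Om is meant to be open, so that neighborhoods of points of Om in R^n and
   in Om give the same local extrema. *)
Definition viscosity_subsolution (Om : set 'rV[R]_n) (u f : 'rV[R]_n -> R) :
    Prop :=
  forall x0 phi, Om x0 -> C2_on Om phi ->
  (\forall x \near x0, u x - phi x <= u x0 - phi x0) ->
  (gradient phi x0 != 0 -> - inf_laplacian phi x0 <= f x0) /\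
  (gradient phi x0 = 0 -> - max_eigenvalue (hessian phi x0) <= f x0).

Definition viscosity_supersolution (Om : set 'rV[R]_n) (u f : 'rV[R]_n -> R) :
    Prop :=
  forall x0 phi, Om x0 -> C2_on Om phi ->
  (\forall x \near x0, u x - phi x >= u x0 - phi x0) ->
  (gradient phi x0 != 0 -> - inf_laplacian phi x0 >= f x0) /\
  (gradient phi x0 = 0 -> - min_eigenvalue (hessian phi x0) >= f x0).

(* u is a viscosity solution of - Delta_oo^N u = f in Om. *)
Definition viscosity_solution (Om : set 'rV[R]_n) (u f : 'rV[R]_n -> R) :
    Prop :=
  [/\ {within Om, continuous u}, viscosity_subsolution Om u f
    & viscosity_supersolution Om u f].

End Differential.

(* Main.v *)
Require Import Defs.
From mathcomp Require Import all_boot all_order all_algebra.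
From mathcomp Require Import all_classical all_reals all_analysis.
From mathcomp Require Import measurable_realfun.
From mathcomp Require Import ring lra.
From mathcomp Require spectral polyrcf.
From mathcomp Require Import complex.
Import Order.TTheory GRing.Theory Num.Theory.
Import numFieldNormedType.Exports.

Set Implicit Arguments.
Unset Strict Implicit.
Unset Printing Implicit Defensive.

Local Open Scope classical_set_scope.
Local Open Scope ring_scope.

(* For a decreasing radial function u = g(|x|) the equation reduces to
   - g'' = f, so the oscillation of u is governed by the one-dimensional
   integrals of f, whereas ||f||_n^n is the integral of f^n r^(n-1): a source
   f ~ 1/(K r) on 2^-K < r < 1 keeps sup u bounded away from 0 while ||f||_n^n
   is of order K^(1-n).  Such a source is obtained from a C^2 profile by
   averaging over j < K the smoothed cones - sqrt(r^2 + a_j^2), a_j = 2^-j: the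
   j-th one has source a_j^2 (r^2 + a_j^2)^(-3/2), which convexity of y^(-1/2)
   bounds by a multiple of (r^2 + a_(j+1)^2)^(-1/2) - (r^2 + a_j^2)^(-1/2), so
   that the sum telescopes.  Its L^n norm is estimated on dyadic cubes.

   Since u is C^2, a test function touching u has the same gradient and an
   ordered Hessian, which settles the case of a nonzero gradient.  At the origin
   the Hessian of u is a multiple of the identity, and it remains to know that
   the Hessian of the test function, symmetric by Schwarz's theorem, has a real
   eigenvalue. *)

(** * Real eigenvalues of symmetric matrices *)

Lemma mulmx_trmx_sum_sqr (R : comNzRingType) n (v : 'rV[R]_n) :
  (v *m v^T) 0 0 = \sum_i v 0 i ^+ 2.
Proof. by rewrite mxE; apply: eq_bigr => i _; rewrite mxE expr2. Qed.

Lemma sum_sqr_gt0 (R : realDomainType) n (v : 'rV[R]_n) :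
  v != 0 -> 0 < \sum_i v 0 i ^+ 2.
Proof.
move=> v0; rewrite lt_def sumr_ge0 ?andbT => [|i _]; last exact: sqr_ge0.
apply: contraNneq v0 => /eqP; rewrite psumr_eq0 => [/allP s0|i _]; last exact: sqr_ge0.
apply/eqP/rowP => i; rewrite mxE; apply/eqP.
by have := s0 i (mem_index_enum i); rewrite implyTb sqrf_eq0.
Qed.

(** Over the complex numbers [X] has an eigenvector a + ib, with eigenvalue al + i be. By symmetry
    the real and imaginary parts satisfy a X b^T = b X a^T, which says be (|a|^2 + |b|^2) = 0. So be
    = 0, and whichever of a and b is nonzero is a real eigenvector. *)
Lemma symmetric_eigenvalue (R : rcfType) n (X : 'M[R]_n) :
  (0 < n)%N -> X^T = X -> exists a, eigenvalue X a.
Proof.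
move=> n0 Xsym.
pose XC := map_mx (complex.real_complex R) X.
have [z /eigenvalueP[w wX w0]] := spectral.eigenvalue_closed XC n0.
case: z wX => al be wX.
pose a := map_mx (@complex.Re R) w; pose b := map_mx (@complex.Im R) w.
have aX : a *m X = al *: a - be *: b.
  apply/rowP => j; have /rowP/(_ j) := wX.
  rewrite !mxE => /(congr1 (@complex.Re R)).
  rewrite raddf_sum /= => E; rewrite -[LHS](_ : \sum_i complex.Re (w 0 i * XC i j) = _).
    by rewrite E; case: (w 0 j).
  by apply: eq_bigr => i _; rewrite !mxE; case: (w 0 i) => x y /=; rewrite mulr0 subr0.
have bX : b *m X = al *: b + be *: a.
  apply/rowP => j; have /rowP/(_ j) := wX.
  rewrite !mxE => /(congr1 (@complex.Im R)).
  rewrite raddf_sum /= => E; rewrite -[LHS](_ : \sum_i complex.Im (w 0 i * XC i j) = _).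
    by rewrite E; case: (w 0 j) => x y /=; rewrite addrC; ring.
  by apply: eq_bigr => i _; rewrite !mxE; case: (w 0 i) => x y /=; rewrite mulr0 add0r.
have ab : a != 0 \/ b != 0.
  have [a0|] := eqVneq a 0; last by left.
  have [b0|] := eqVneq b 0; last by right.
  case/eqP: w0; apply/rowP => i; rewrite mxE.
  move/rowP/(_ i): a0; move/rowP/(_ i): b0; rewrite !mxE.
  by case: (w 0 i) => x y /= -> ->.
have be0 : be = 0.
  have sym : (a *m X *m b^T) 0 0 = (b *m X *m a^T) 0 0.
    rewrite -[in RHS](trmxK (b *m X *m a^T)) [in RHS]mxE.
    by rewrite !trmx_mul trmxK Xsym mulmxA.
  have abC : (a *m b^T) 0 0 = (b *m a^T) 0 0.
    by rewrite -[in RHS](trmxK (b *m a^T)) [in RHS]mxE trmx_mul trmxK.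
  move: sym; rewrite aX bX mulmxBl mulmxDl -!scalemxAl.
  rewrite [LHS]mxE [in LHS]mxE [X in _ + X = _]mxE [in X in _ + X = _]mxE.
  rewrite [RHS]mxE [in RHS]mxE [in X in _ = _ + X]mxE abC !mulmx_trmx_sum_sqr => sym.
  have : be * (\sum_i a 0 i ^+ 2 + \sum_i b 0 i ^+ 2) = 0 by lra.
  move/eqP; rewrite mulf_eq0 => /orP[/eqP//|/eqP s0]; exfalso.
  have sa : 0 <= \sum_i a 0 i ^+ 2 by apply: sumr_ge0 => i _; exact: sqr_ge0.
  have sb : 0 <= \sum_i b 0 i ^+ 2 by apply: sumr_ge0 => i _; exact: sqr_ge0.
  by case: ab => /sum_sqr_gt0; lra.
exists al; apply/eigenvalueP; case: ab => [a0|b0].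
  by exists a => //; rewrite aX be0 scale0r subr0.
by exists b => //; rewrite bX be0 scale0r addr0.
Qed.

(** Cauchy's bound on the roots of the characteristic polynomial; it makes the [sup] and [inf] of
    the spectrum comparable with its elements. *)
Lemma eigenvalue_bound (R : rcfType) n (X : 'M[R]_n) :
  exists M : R, forall a, eigenvalue X a -> `|a| <= M.
Proof.
exists (polyrcf.cauchy_bound (char_poly X)) => a.
rewrite eigenvalue_root_char => /rootP; move/polyrcf.cauchy_boundP => H.
by apply/ltW/H/monic_neq0/char_poly_monic.
Qed.

Lemma eigenvalue_quadratic (F : realFieldType) n (X : 'M[F]_n) a :
  eigenvalue X a ->
  exists2 v : 'rV[F]_n, 0 < \sum_i v 0 i ^+ 2 &
    (v *m X *m v^T) 0 0 = a * \sum_i v 0 i ^+ 2.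
Proof.
move=> /eigenvalueP[v vX v0]; exists v; first exact: sum_sqr_gt0.
by rewrite vX -scalemxAl mxE mulmx_trmx_sum_sqr.
Qed.

(** A single real eigenvalue suffices: the quadratic form at its eigenvector shows that it is at
    least [c], and it lies below the supremum. *)
Lemma max_eigenvalue_ge (R : realType) n (X : 'M[R]_n) (c : R) :
  (0 < n)%N -> X^T = X ->
  (forall v : 'rV_n, c * \sum_i v 0 i ^+ 2 <= (v *m X *m v^T) 0 0) ->
  c <= max_eigenvalue X.
Proof.
move=> n0 Xsym cX; have [a aX] := symmetric_eigenvalue n0 Xsym.
have [v v0 vX] := eigenvalue_quadratic aX.
apply: (@le_trans _ _ a); first by rewrite -(ler_pM2r v0) -vX.
have [M XM] := eigenvalue_bound X.
apply: ub_le_sup => //; exists M => b /XM; exact/le_trans/ler_norm.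
Qed.

Lemma min_eigenvalue_le (R : realType) n (X : 'M[R]_n) (c : R) :
  (0 < n)%N -> X^T = X ->
  (forall v : 'rV_n, (v *m X *m v^T) 0 0 <= c * \sum_i v 0 i ^+ 2) ->
  min_eigenvalue X <= c.
Proof.
move=> n0 Xsym cX; have [a aX] := symmetric_eigenvalue n0 Xsym.
have [v v0 vX] := eigenvalue_quadratic aX.
apply: (@le_trans _ _ a); last by rewrite -(ler_pM2r v0) -vX.
have [M XM] := eigenvalue_bound X.
by apply: ge_inf => //; exists (- M) => b /XM; rewrite ler_norml => /andP[].
Qed.

(** * Second-order calculus in R^n *)

Lemma is_derive_line (R : realType) (V : normedModType R) (phi : V -> R)
    (y v : V) (s : R) :
  derivable phi (s *: v + y) v ->
  is_derive s 1 (fun t : R => phi (t *: v + y)) ('D_v phi (s *: v + y)).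
Proof.
have E : (fun h : R => h^-1 *: (((fun t => phi (t *: v + y)) \o shift s) (h *: 1)
                             - phi (s *: v + y))) =
         (fun h => h^-1 *: ((phi \o shift (s *: v + y)) (h *: v) - phi (s *: v + y))).
  by apply/funext => h /=; rewrite [h *: 1]mulr1 scalerDl addrA.
by move=> d; split; rewrite /derivable /derive E.
Qed.

(** The intermediate point is located by |s| <= |t| only, so that later uses need not distinguish
    the sign of [t]. *)
Lemma MVT_line (R : realType) (V : normedModType R) (phi : V -> R)
    (y v : V) (t : R) :
  (forall s : R, `|s| <= `|t| -> derivable phi (s *: v + y) v) ->
  exists2 s, `|s| <= `|t| &
    phi (t *: v + y) - phi y = t * 'D_v phi (s *: v + y).
Proof.
move=> dphi.
have dline (s : R) : `|s| <= `|t| -> is_derive s 1 (fun r : R => phi (r *: v + y)) ('D_v phi (s *: v + y)).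
  by move=> /dphi; exact: is_derive_line.
have cline (a b : R) : (forall s, s \in `[a, b]%R -> `|s| <= `|t|) ->
    {within `[a, b], continuous (fun r : R => phi (r *: v + y))}.
  by move=> abt; apply: derivable_within_continuous => s /abt /dline [].
have [t0|t0|t0] := ltgtP t 0.
- have tN s : s \in `[t, 0]%R -> `|s| <= `|t|.
    by rewrite in_itv/= => /andP[ts s0]; rewrite !ler0_norm ?lerN2// ltW.
  have [s|s s01] := @MVT _ _ (fun s => 'D_v phi (s *: v + y)) t 0 t0 _ (cline _ _ tN).
    by move=> /subset_itv_oo_cc /tN /dline.
  rewrite scale0r add0r sub0r mulrN => /eqP; rewrite -eqr_opp opprK opprB => /eqP E.
  by exists s; [exact/tN/subset_itv_oo_cc|rewrite E mulrC].
- have tP s : s \in `[0, t]%R -> `|s| <= `|t|.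
    by rewrite in_itv/= => /andP[s0 st]; rewrite !ger0_norm// (le_trans s0).
  have [s|s s01] := @MVT _ _ (fun s => 'D_v phi (s *: v + y)) 0 t t0 _ (cline _ _ tP).
    by move=> /subset_itv_oo_cc /tP /dline.
  rewrite scale0r add0r subr0 => E.
  by exists s; [exact/tP/subset_itv_oo_cc|rewrite E mulrC].
- by exists 0; rewrite t0 ?normr0// scale0r add0r subrr mul0r.
Qed.

(** The first claim is Fermat's rule. If c > 0, then [dpsi] is positive just to the right of 0, and
    the mean value theorem gives psi t > psi 0 for a small t > 0, against maximality. *)
Lemma second_order_max (R : realType) (psi dpsi : R -> R) (c : R) :
  (\forall t \near (0 : R), is_derive (t : R) 1 psi (dpsi t)) -> is_derive (0 : R) 1 dpsi c ->
  (\forall t \near (0 : R), psi t <= psi 0) -> dpsi 0 = 0 /\ c <= 0.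
Proof.
move=> dpsiE ddpsi maxpsi.
have /nbhs_normP[e /= e0 He] : \forall t \near (0 : R), is_derive (t : R) 1 psi (dpsi t) /\ psi t <= psi 0.
  by near=> t; split; near: t.
have {He} Hpsi (t : R) : `|t| < e -> is_derive t 1 psi (dpsi t) /\ psi t <= psi 0.
  by move=> te; apply: He; rewrite /= sub0r normrN.
have itv_e t : t \in `]- e, e[%R -> `|t| < e by rewrite in_itv/= ltr_norml.
have d0 : dpsi 0 = 0.
  have [|[_ <-] _] := Hpsi 0; first by rewrite normr0.
  apply: derive_val; apply: (@derive1_at_max _ _ (- e) e 0).
  - by rewrite (le_trans _ (ltW e0))// oppr_le0 ltW.
  - by move=> t /itv_e /Hpsi[[]].
  - by rewrite in_itv/= oppr_lt0 e0.
  - by move=> t /itv_e /Hpsi[].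
split=> //; rewrite leNgt; apply/negP => c0.
have : \forall h \near (0 : R)^', 0 < h^-1 *: ((dpsi \o shift 0) (h *: 1) - dpsi 0).
  have cv : h^-1 *: ((dpsi \o shift 0) (h *: 1) - dpsi 0) @[h --> 0^'] --> c.
    by case: ddpsi => cv <-.
  by apply: (cvgr_gt _ cv).
rewrite near_withinE => /nbhs_normP[d /= dgt0 Hd].
(* Small enough for both neighborhoods: within [e], psi is at most psi 0; within [d], the difference
   quotients of [dpsi] are positive. *)
pose t := Num.min e d / 2.
have m0 : 0 < Num.min e d by rewrite lt_min e0.
have t0 : 0 < t by rewrite /t divr_gt0.
have te : t < e.
  by apply: (@lt_le_trans _ _ (Num.min e d)); rewrite ?ge_min ?lexx// /t ltr_pdivrMr// ltr_pMr// ltr1n.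
have td : t < d.
  by apply: (@lt_le_trans _ _ (Num.min e d)); rewrite ?ge_min ?lexx ?orbT// /t ltr_pdivrMr// ltr_pMr// ltr1n.
have in_e s : s \in `[0, t]%R -> `|s| < e.
  by rewrite in_itv/= => /andP[s0 st]; rewrite ger0_norm// (le_lt_trans st).
have [s||s sI E] := @MVT _ psi dpsi 0 t t0.
- by move=> /subset_itv_oo_cc /in_e /Hpsi[].
- by apply: derivable_within_continuous => s /in_e /Hpsi[[]].
have [|_] := Hpsi t; first by rewrite gtr0_norm.
apply/negP; rewrite -ltNge -subr_gt0 E subr0 pmulr_lgt0//.
move: sI; rewrite in_itv/= => /andP[s0 st].
have := Hd s; rewrite /= sub0r normrN gtr0_norm// => /(_ (lt_trans st td)).
rewrite gt_eqF// => /(_ isT); rewrite addr0 d0 subr0 [s *: 1]mulr1.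
by rewrite [_ *: _]/(_ * _) pmulr_rgt0// invr_gt0.
Unshelve. all: by end_near. Qed.

Lemma second_order_min (R : realType) (psi dpsi : R -> R) (c : R) :
  (\forall t \near (0 : R), is_derive (t : R) 1 psi (dpsi t)) -> is_derive (0 : R) 1 dpsi c ->
  (\forall t \near (0 : R), psi t >= psi 0) -> dpsi 0 = 0 /\ 0 <= c.
Proof.
move=> dpsiE ddpsi minpsi.
have [||/eqP] := @second_order_max _ (- psi) (- dpsi) (- c).
- by near=> t; apply: is_deriveN; near: t.
- by near=> t; rewrite lerN2; near: t.
by rewrite oppr_eq0 oppr_le0 => /eqP.
Unshelve. all: by end_near. Qed.

(** * Directional derivatives from continuous partial derivatives *)

Lemma ler_mx_norm (R : realType) n (w : 'rV[R]_n) (M : R) :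
  0 <= M -> (forall i, `|w 0 i| <= M) -> `|w| <= M.
Proof.
move=> M0 wM; rewrite [`|w|]mx_normrE.
by apply/bigmax_leP; split=> // -[i j] _ /=; rewrite ord1.
Qed.

Lemma normr_coord_le (R : realType) n (w : 'rV[R]_n) i : `|w 0 i| <= `|w|.
Proof.
rewrite [X in _ <= X]mx_normrE.
by apply: (@le_bigmax _ _ _ 0 (fun ij : 'I_1 * 'I_n => `|w ij.1 ij.2|) (0, i)).
Qed.

(* Moving from x to x + w one coordinate at a time; the first k coordinates are
   already in place. *)
Lemma increment_partial_le (R : realType) n (phi : 'rV[R]_n -> R)
    (x w : 'rV[R]_n) (eps : R) :
  (forall y i, `|y - x| <= `|w| -> derivable phi y (delta_mx 0 i)) ->
  (forall y i, `|y - x| <= `|w| -> `|partial i phi y - partial i phi x| <= eps) ->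
  `|phi (w + x) - phi x - \sum_i w 0 i * partial i phi x| <= eps * \sum_i `|w 0 i|.
Proof.
move=> dphi peps.
pose wk k : 'rV[R]_n := \row_i (if (i < k)%N then w 0 i else 0).
suff H k : (k <= n)%N ->
    `|phi (wk k + x) - phi x - \sum_(i < n | (i < k)%N) w 0 i * partial i phi x|
      <= eps * \sum_(i < n | (i < k)%N) `|w 0 i|.
  have := H n (leqnn n).
  have -> : wk n = w by apply/rowP => i; rewrite mxE ltn_ord.
  rewrite (eq_bigl xpredT) => [|i]; last by rewrite ltn_ord.
  by rewrite [in X in _ <= X](eq_bigl xpredT) => [|i]; last by rewrite ltn_ord.
elim: k => [_|k IH kn].
  have -> : wk 0%N = 0 by apply/rowP => i; rewrite !mxE.
  by rewrite !big_pred0// add0r subrr subr0 normr0 mulr0.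
pose o := Ordinal kn.
have bigS (F : 'I_n -> R) :
    \sum_(i < n | (i < k.+1)%N) F i = F o + \sum_(i < n | (i < k)%N) F i.
  rewrite (bigD1 o) ?ltnSn//=; congr (_ + _); apply: eq_bigl => i.
  by rewrite ltnS -val_eqE /= [RHS]ltn_neqAle andbC.
have wkS : wk k.+1 = w 0 o *: delta_mx 0 o + wk k.
  apply/rowP => i; rewrite !mxE eqxx /= -val_eqE /= ltnS leq_eqVlt.
  case: (ltngtP i k) => //= [||ik]; rewrite ?mulr0 ?add0r ?addr0//.
  by rewrite mulr1; congr (w 0 _); apply/val_inj.
(* The norm is the sup norm, so the whole coordinatewise path stays within |w| of [x]. *)
have close (s : R) : `|s| <= `|w 0 o| -> `|(s *: delta_mx 0 o + (wk k + x)) - x| <= `|w|.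
  move=> sw; rewrite addrA addrK; apply: ler_mx_norm => // i.
  rewrite !mxE eqxx /= -val_eqE /=.
  case: (ltngtP i k) => //= [||ik]; rewrite ?mulr0 ?add0r ?addr0 ?normr0//.
    by rewrite normr_coord_le.
  by rewrite mulr1 (le_trans sw)// normr_coord_le.
have [s sw E] := @MVT_line _ _ phi (wk k + x) (delta_mx 0 o) (w 0 o)
  (fun s sw => dphi _ _ (close s sw)).
rewrite !bigS wkS -[_ *: _ + wk k + x]addrA.
have -> : phi (w 0 o *: delta_mx 0 o + (wk k + x)) - phi x -
    (w 0 o * partial o phi x + \sum_(i < n | (i < k)%N) w 0 i * partial i phi x) =
    w 0 o * (partial o phi (s *: delta_mx 0 o + (wk k + x)) - partial o phi x) +
   (phi (wk k + x) - phi x - \sum_(i < n | (i < k)%N) w 0 i * partial i phi x).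
  have -> : w 0 o * (partial o phi (s *: delta_mx 0 o + (wk k + x)) - partial o phi x) =
      phi (w 0 o *: delta_mx 0 o + (wk k + x)) - phi (wk k + x) - w 0 o * partial o phi x.
    by rewrite E mulrBr.
  set A := phi _; set B := phi _; set C := phi _; set D := w 0 o * _; set F := \sum_(_ | _) _.
  clear; ring.
rewrite (le_trans (ler_normD _ _))// [leRHS]mulrDr; apply: lerD.
  by rewrite normrM mulrC ler_wpM2r//; apply/peps/close.
exact/IH/ltnW.
Qed.

(** Near [x] the partial derivatives vary little, so the increment of phi along h v differs from its
    linear part by at most a small multiple of |h|; it remains to divide by h. *)
Lemma is_derive_partials (R : realType) n (phi : 'rV[R]_n -> R) (x v : 'rV[R]_n) :
  (\forall y \near x, forall i, derivable phi y (delta_mx 0 i)) ->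
  (forall i, {for x, continuous (partial i phi)}) ->
  is_derive x v phi (\sum_i v 0 i * partial i phi x).
Proof.
move=> dphi cphi.
suff cv : h^-1 *: ((phi \o shift x) (h *: v) - phi x) @[h --> 0^'] -->
    \sum_i v 0 i * partial i phi x.
  by split; [apply/cvg_ex; eexists; exact: cv | exact: cvg_lim].
apply/cvgrPdist_le => eps eps0.
(* The summand 1 keeps [S] positive when v = 0; the oscillation eps / S of the partial derivatives
   then gives a total error of at most eps. *)
pose S := 1 + \sum_i `|v 0 i|.
have S0 : 0 < S by rewrite ltr_pwDl// sumr_ge0.
have eS0 : 0 < eps / S by rewrite divr_gt0.
have : \forall y \near x, (forall i, derivable phi y (delta_mx 0 i)) /\
    forall i, `|partial i phi y - partial i phi x| <= eps / S.
  near=> y; split; first by near: y.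
  near: y; apply: filter_forall => i.
  by have /cvgrPdistC_le/(_ _ eS0) := cphi i.
move=> /nbhs_normP[d /= d0 Hd].
near=> h.
have hv : `|h *: v| < d.
  have v0 : 0 < 1 + `|v| by rewrite ltr_pwDl.
  have hd : `|h| < d / (1 + `|v|) by near: h; apply: dnbhs0_lt; rewrite divr_gt0.
  rewrite normrZ (@le_lt_trans _ _ (`|h| * (1 + `|v|))) -?ltr_pdivlMr//.
  by rewrite ler_wpM2l// lerDr.
have h0 : h != 0 by near: h; exact: nbhs_dnbhs_neq.
have Hd' y : `|y - x| <= `|h *: v| -> (forall i, derivable phi y (delta_mx 0 i)) /\
    forall i, `|partial i phi y - partial i phi x| <= eps / S.
  by move=> yx; apply: Hd; rewrite /= distrC (le_lt_trans yx).
rewrite distrC.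
have := @increment_partial_le _ _ phi x (h *: v) (eps / S)
  (fun y i yx => (Hd' y yx).1 i) (fun y i yx => (Hd' y yx).2 i).
have -> : \sum_i (h *: v) 0 i * partial i phi x = h * \sum_i v 0 i * partial i phi x.
  by rewrite mulr_sumr; apply: eq_bigr => i _; rewrite mxE mulrA.
have -> : \sum_i `|(h *: v) 0 i| = `|h| * \sum_i `|v 0 i|.
  by rewrite mulr_sumr; apply: eq_bigr => i _; rewrite mxE normrM.
move=> H.
have -> : h^-1 *: ((phi \o shift x) (h *: v) - phi x) - \sum_i v 0 i * partial i phi x
   = h^-1 * (phi (h *: v + x) - phi x - h * \sum_i v 0 i * partial i phi x).
  by rewrite [RHS]mulrBr mulKf.
rewrite normrM normfV ler_pdivrMl ?normr_gt0// (le_trans H)//.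
rewrite mulrCA ler_wpM2l// mulrAC ler_pdivrMr// ler_wpM2l// 1?ltW//.
by rewrite ltrDr.
Unshelve. all: by end_near. Qed.

(** * Schwarz's theorem on mixed second derivatives *)

Lemma normr_delta_mx_le1 (R : realType) n (i : 'I_n) :
  `|delta_mx 0 i : 'rV[R]_n| <= 1.
Proof.
by apply: ler_mx_norm => // j; rewrite mxE eqxx /=; case: eqP; rewrite ?normr1 ?normr0.
Qed.

(** The mean value theorem is applied twice: along e_i to y |-> phi (y + h e_j) - phi y, then along
    e_j to the i-th partial derivative. The left side is symmetric in [i] and [j], which is what
    Schwarz's theorem exploits. *)
Lemma double_difference_MVT (R : realType) n (phi : 'rV[R]_n -> R) (x : 'rV[R]_n)
    (i j : 'I_n) (h : R) :
  (forall y, `|y - x| <= 2 * `|h| ->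
     derivable phi y (delta_mx 0 i) /\ derivable (partial i phi) y (delta_mx 0 j)) ->
  exists2 y, `|y - x| <= 2 * `|h| &
    phi (h *: delta_mx 0 i + (h *: delta_mx 0 j + x)) - phi (h *: delta_mx 0 j + x)
      - (phi (h *: delta_mx 0 i + x) - phi x) =
    h * (h * partial j (partial i phi) y).
Proof.
move=> dphi.
have norme (s : R) (k : 'I_n) : `|s| <= `|h| -> `|s *: delta_mx 0 k : 'rV[R]_n| <= `|h|.
  by move=> sh; rewrite normrZ (le_trans _ sh)// ler_piMr// normr_delta_mx_le1.
have close (s r : R) : `|s| <= `|h| -> `|r| <= `|h| ->
    `|s *: delta_mx 0 i + (r *: delta_mx 0 j + x) - x| <= 2 * `|h|.
  move=> sh rh; rewrite addrA addrK (le_trans (ler_normD _ _))//.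
  by rewrite mulr_natl mulr2n lerD// norme.
have close0 (s : R) : `|s| <= `|h| -> `|s *: delta_mx 0 i + x - x| <= 2 * `|h|.
  by move=> sh; have := close s 0 sh; rewrite scale0r add0r normr0; exact.
pose F y := phi (y + h *: delta_mx 0 j) - phi y.
have dF (s : R) : `|s| <= `|h| ->
    is_derive (s *: delta_mx 0 i + x) (delta_mx 0 i) F
     (partial i phi (s *: delta_mx 0 i + (h *: delta_mx 0 j + x)) -
      partial i phi (s *: delta_mx 0 i + x)).
  move=> sh.
  apply: is_deriveB; last exact/derivableP/(dphi _ (close0 _ sh)).1.
  have := derivableP (dphi _ (close _ _ sh (lexx _))).1.
  have E : (fun r : R => r^-1 *: (((fun y => phi (y + h *: delta_mx 0 j)) \o
        shift (s *: delta_mx 0 i + x)) (r *: delta_mx 0 i) -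
        phi (s *: delta_mx 0 i + x + h *: delta_mx 0 j))) =
     (fun r => r^-1 *: ((phi \o shift (s *: delta_mx 0 i + (h *: delta_mx 0 j + x)))
         (r *: delta_mx 0 i) - phi (s *: delta_mx 0 i + (h *: delta_mx 0 j + x)))).
    have sC : s *: delta_mx 0 i + x + h *: delta_mx 0 j =
              s *: delta_mx 0 i + (h *: delta_mx 0 j + x).
      by rewrite -addrA [x + _]addrC.
    by apply/funext => r /=; rewrite sC -addrA sC.
  by move=> [d1 d2]; split; rewrite /derivable /derive E.
have [|s sh EF] := @MVT_line _ _ F x (delta_mx 0 i) h; first by move=> s /dF[].
rewrite (@derive_val _ _ _ _ _ _ _ (dF s sh)) in EF.
have dp (r : R) : `|r| <= `|h| ->
    derivable (partial i phi) (r *: delta_mx 0 j + (s *: delta_mx 0 i + x)) (delta_mx 0 j).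
  by move=> rh; rewrite addrCA; exact: (dphi _ (close _ _ sh rh)).2.
have [r rh Er] := @MVT_line _ _ (partial i phi) (s *: delta_mx 0 i + x) (delta_mx 0 j) h dp.
exists (r *: delta_mx 0 j + (s *: delta_mx 0 i + x)).
  by rewrite addrCA; exact: close.
rewrite [partial j _ _]/('D_(delta_mx 0 j) (partial i phi) _) -Er.
rewrite [h *: _ + (s *: _ + _)]addrCA -EF /F.
have xC : x + h *: delta_mx 0 j = h *: delta_mx 0 j + x by rewrite addrC.
rewrite -[_ + x + h *: _]addrA xC.
set a := phi _; set b := phi _; set c := phi _; set e := phi _.
by clear; ring.
Qed.

(** The second difference is h^2 times either mixed derivative, each taken at some point near [x],
    so these two values coincide. If the mixed derivatives at [x] were D > 0 apart, each value would
    be within D/2 of its own limit, which is impossible. *)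
Lemma partialC (R : realType) n (phi : 'rV[R]_n -> R) (x : 'rV[R]_n) (i j : 'I_n) :
  (\forall y \near x, forall i j, derivable phi y (delta_mx 0 i) /\
     derivable (partial i phi) y (delta_mx 0 j)) ->
  (forall i j, {for x, continuous (partial i (partial j phi))}) ->
  partial i (partial j phi) x = partial j (partial i phi) x.
Proof.
move=> dphi cphi; apply/eqP/negPn/negP; rewrite -subr_eq0 -normr_gt0.
have [D DE] : exists D, D = `|partial i (partial j phi) x - partial j (partial i phi) x|.
  by eexists.
rewrite -DE => D0.
have D2 : 0 < D / 2 by rewrite divr_gt0.
have ci : \forall y \near x,
    `|partial i (partial j phi) y - partial i (partial j phi) x| < D / 2.
  by move: (cphi i j) => /cvgrPdistC_lt/(_ _ D2); exact.
have cj : \forall y \near x,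
    `|partial j (partial i phi) y - partial j (partial i phi) x| < D / 2.
  by move: (cphi j i) => /cvgrPdistC_lt/(_ _ D2); exact.
have : \forall y \near x, (forall i j, derivable phi y (delta_mx 0 i) /\
     derivable (partial i phi) y (delta_mx 0 j)) /\
    (`|partial i (partial j phi) y - partial i (partial j phi) x| < D / 2 /\
     `|partial j (partial i phi) y - partial j (partial i phi) x| < D / 2).
  exact: filterI dphi (filterI ci cj).
move=> /nbhs_normP[d /= d0 Hd].
pose h := d / 3.
have h0 : 0 < h by rewrite divr_gt0.
have hd : 2 * `|h| < d by rewrite gtr0_norm// /h; lra.
have {}Hd y (yx : `|y - x| <= 2 * `|h|) := Hd y (eq_ind_r (fun e => e < d) (le_lt_trans yx hd) (distrC x y)).
have dd k l y (yx : `|y - x| <= 2 * `|h|) := (Hd y yx).1 k l.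
have [y yx Ey] := double_difference_MVT (dd i j).
have [z zx Ez] := double_difference_MVT (dd j i).
have yz : partial j (partial i phi) y = partial i (partial j phi) z.
  move: Ey Ez; rewrite [h *: delta_mx 0 i + (h *: _ + x)]addrCA.
  move: (partial j _ y) (partial i _ z) => p q.
  move: (phi _) (phi _) (phi _) (phi x) => A B C E Ey Ez.
  apply/(mulfI (lt0r_neq0 h0))/(mulfI (lt0r_neq0 h0)); rewrite -Ey -Ez.
  by clear; ring.
have := (Hd _ yx).2.2; have := (Hd _ zx).2.1; rewrite yz; move: DE.
move: (partial i (partial j phi) x) (partial j (partial i phi) x) (partial i (partial j phi) z).
move=> p q r DE rp rq; clear -DE rp rq.
suff : D < D by rewrite ltxx.
rewrite {1}DE -(subrK r p) -addrA (le_lt_trans (ler_normD _ _))// distrC.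
by rewrite [ltRHS](splitr D) ltrD.
Qed.

Lemma C2_on_near (R : realType) n (Om : set 'rV[R]_n) (phi : 'rV[R]_n -> R) (x : 'rV[R]_n) :
  open Om -> C2_on Om phi -> Om x ->
  \forall y \near x, forall i j, derivable phi y (delta_mx 0 i) /\
     derivable (partial i phi) y (delta_mx 0 j).
Proof.
move=> oOm C2 Ox; apply: filterS (open_nbhs_nbhs (conj oOm Ox)) => y /C2[_ d1 d2] i j.
by split; [exact: (d1 i).1|exact: (d2 j i).1].
Qed.

Lemma hessian_sym (R : realType) n (Om : set 'rV[R]_n) (phi : 'rV[R]_n -> R)
    (x : 'rV[R]_n) :
  open Om -> C2_on Om phi -> Om x -> (hessian phi x)^T = hessian phi x.
Proof.
move=> oOm C2 Ox; apply/matrixP => i j; rewrite !mxE; apply: partialC.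
  exact: C2_on_near C2 Ox.
by move=> k l; have [_ _ /(_ k l)[]] := C2 _ Ox.
Qed.

(** * Restriction of C^2 functions to lines *)

Lemma cvg_line (R : realType) n (x v : 'rV[R]_n) :
  (t *: v + x) @[t --> (0 : R)] --> x.
Proof.
have : {for (0 : R), continuous (fun t : R => t *: v + x)}.
  by move=> ?; apply: cvgD; [exact: scalel_continuous|exact: cvg_cst].
by rewrite /prop_for /continuous_at /= scale0r add0r => cl; exact: cl.
Qed.

(** This puts a test function in the form required by [second_order_max] and [second_order_min], so
    that contact is studied in one variable, direction by direction. *)
Lemma C2_on_line (R : realType) n (Om : set 'rV[R]_n) (phi : 'rV[R]_n -> R)
    (x v : 'rV[R]_n) :
  open Om -> C2_on Om phi -> Om x ->
  (\forall t \near (0 : R), is_derive (t : R) 1 (fun t : R => phi (t *: v + x))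
      (\sum_i v 0 i * partial i phi (t *: v + x))) /\
  is_derive (0 : R) 1 (fun t : R => \sum_i v 0 i * partial i phi (t *: v + x))
    ((v *m hessian phi x *m v^T) 0 0).
Proof.
move=> oOm C2 Ox; split.
  have : \forall y \near x, is_derive y v phi (\sum_i v 0 i * partial i phi y).
    apply: filterS (open_nbhs_nbhs (conj oOm Ox)) => y Oy.
    apply: is_derive_partials.
      by apply: filterS (C2_on_near oOm C2 Oy) => z dz i; exact: (dz i i).1.
    by move=> i; have [_ /(_ i)[]] := C2 _ Oy.
  move=> dphi; near=> t.
  have [d1 <-] : is_derive (t *: v + x) v phi (\sum_i v 0 i * partial i phi (t *: v + x)).
    by near: t; exact: (@cvg_line _ _ x v _ dphi).
  exact: is_derive_line.
have dpart j : is_derive x v (partial j phi) (\sum_i v 0 i * partial i (partial j phi) x).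
  apply: is_derive_partials.
    by apply: filterS (C2_on_near oOm C2 Ox) => z dz i; exact: (dz j i).2.
  by move=> i; have [_ _ /(_ i j)[]] := C2 _ Ox.
have -> : (v *m hessian phi x *m v^T) 0 0 =
    \sum_j v 0 j * (\sum_i v 0 i * partial i (partial j phi) x).
  rewrite mxE; apply: eq_bigr => j _; rewrite !mxE mulrC; congr (_ * _).
  by apply: eq_bigr => i _; rewrite !mxE.
have -> : (fun t : R => \sum_i v 0 i * partial i phi (t *: v + x)) =
   \sum_i (fun t : R => v 0 i * partial i phi (t *: v + x)).
  by apply/funext => t; rewrite fct_sumE.
apply: is_derive_sum => j.
apply: (@is_deriveZ _ _ _ (fun t : R => partial j phi (t *: v + x)) (v 0 j)).
have [d1 <-] := dpart j.
have := @is_derive_line _ _ (partial j phi) x v 0.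
rewrite scale0r add0r => H; exact: (H d1).
Unshelve. all: by end_near. Qed.

(** * Radial viscosity solutions *)

(** Radial functions are written in terms of s = |x|^2 instead of |x|: the square is a polynomial in
    the coordinates, hence smooth at the origin too. *)
Definition sqnorm (R : realType) n (x : 'rV[R]_n) : R := \sum_i x 0 i ^+ 2.

Lemma sqnorm_ge0 (R : realType) n (x : 'rV[R]_n) : 0 <= sqnorm x.
Proof. by apply: sumr_ge0 => i _; exact: sqr_ge0. Qed.

Lemma sqnormZ (R : realType) n (a : R) (x : 'rV[R]_n) :
  sqnorm (a *: x) = a ^+ 2 * sqnorm x.
Proof. by rewrite /sqnorm mulr_sumr; apply: eq_bigr => i _; rewrite mxE exprMn. Qed.

Lemma sqnorm_eq0 (R : realType) n (x : 'rV[R]_n) : (sqnorm x == 0) = (x == 0).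
Proof.
have [->|x0] := eqVneq x 0.
  by apply/eqP; apply: big1 => i _; rewrite mxE expr0n.
by rewrite gt_eqF// sum_sqr_gt0.
Qed.

Lemma eucl_norm_sqr (R : realType) n (x : 'rV[R]_n) : eucl_norm x ^+ 2 = sqnorm x.
Proof. by rewrite sqr_sqrtr// sqnorm_ge0. Qed.

Lemma sqnorm_normalized (R : realType) n (x : 'rV[R]_n) :
  x != 0 -> sqnorm ((eucl_norm x)^-1 *: x) = 1.
Proof.
by move=> x0; rewrite sqnormZ exprVn eucl_norm_sqr mulVf// sqnorm_eq0.
Qed.

Lemma continuous_sqnorm (R : realType) n : continuous (@sqnorm R n).
Proof.
move=> x; apply: (@cvg_big _ _ +%R 0 xpredT _ _ (nbhs x) _ (fun i (y : 'rV[R]_n) => y 0 i ^+ 2)).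
  exact: (@add_continuous R^o).
move=> i _.
exact: (continuous_comp (@coord_continuous _ _ _ 0 i x) (@exprn_continuous R 2 (x 0 i))).
Qed.

Lemma open_unit_ball (R : realType) n : open (unit_ball R n).
Proof.
have -> : unit_ball R n = @sqnorm R n @^-1` [set r : R | r < 1].
  apply/seteqP; split => x /=; rewrite /unit_ball /= -eucl_norm_sqr expr_lt1// ?sqrtr_ge0//.
by apply: open_comp => [x _|]; [exact: continuous_sqnorm|exact: open_lt].
Qed.

Lemma sqnorm_line (R : realType) n (x v : 'rV[R]_n) (t : R) :
  sqnorm (t *: v + x) =
  (sqnorm v *: 'X^2 + (2 * \sum_i v 0 i * x 0 i) *: 'X + (sqnorm x)%:P).[t].
Proof.
rewrite !hornerD !hornerZ hornerXn hornerX hornerC /sqnorm mulr_sumr !mulr_suml -!big_split /=.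
by apply: eq_bigr => i _; rewrite !mxE; ring.
Qed.

Lemma is_derive_sqnorm_line (R : realType) n (x v : 'rV[R]_n) (t : R) :
  is_derive t 1 (fun t : R => sqnorm (t *: v + x))
    (2 * sqnorm v * t + 2 * \sum_i v 0 i * x 0 i).
Proof.
rewrite (_ : (fun t : R => sqnorm _) =
  horner (sqnorm v *: 'X^2 + (2 * \sum_i v 0 i * x 0 i) *: 'X + (sqnorm x)%:P)); last first.
  by apply/funext => r; rewrite sqnorm_line.
apply: is_derive_eq.
by rewrite !poly.derivE !hornerE /=; ring.
Qed.

Section RadialFunction.
Variables (R : realType) (n : nat) (G G1 G2 : R -> R).
Hypothesis dG : forall s : R, 0 <= s -> is_derive s 1 G (G1 s).
Hypothesis dG1 : forall s : R, 0 <= s -> is_derive s 1 G1 (G2 s).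

Let u (x : 'rV[R]_n) := G (sqnorm x).

Lemma continuous_radial : continuous u.
Proof.
move=> x; apply: continuous_comp; first exact: continuous_sqnorm.
by apply/differentiable_continuous/derivable1_diffP; have [] := dG (sqnorm_ge0 x).
Qed.

Lemma radial_line (x v : 'rV[R]_n) (t : R) :
  is_derive t 1 (fun t : R => u (t *: v + x))
    (G1 (sqnorm (t *: v + x)) * (2 * sqnorm v * t + 2 * \sum_i v 0 i * x 0 i)).
Proof.
apply: (@is_derive1_comp _ G (fun t : R => sqnorm (t *: v + x))).
  exact/dG/sqnorm_ge0.
exact: is_derive_sqnorm_line.
Qed.

Lemma radial_line2 (x v : 'rV[R]_n) :
  is_derive (0 : R) 1
    (fun t : R => G1 (sqnorm (t *: v + x)) * (2 * sqnorm v * t + 2 * \sum_i v 0 i * x 0 i))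
    (2 * sqnorm v * G1 (sqnorm x) + 4 * (\sum_i v 0 i * x 0 i) ^+ 2 * G2 (sqnorm x)).
Proof.
set b := \sum_i _.
have d1 : is_derive (0 : R) 1 (fun t : R => G1 (sqnorm (t *: v + x))) (G2 (sqnorm x) * (2 * b)).
  have x0 : 0 *: v + x = x by rewrite scale0r add0r.
  have dq := is_derive_sqnorm_line x v 0.
  rewrite mulr0 add0r in dq.
  apply: (@is_derive1_comp _ G1 (fun t : R => sqnorm (t *: v + x))) dq.
  by rewrite /= x0; exact/dG1/sqnorm_ge0.
have d2 : is_derive (0 : R) 1 (fun t : R => 2 * sqnorm v * t + 2 * b) (2 * sqnorm v).
  rewrite (_ : (fun t : R => _) = horner ((2 * sqnorm v) *: 'X + (2 * b)%:P)); last first.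
    by apply/funext => t; rewrite !hornerE.
  by apply: is_derive_eq; rewrite !poly.derivE !hornerE.
have := is_deriveM d1 d2.
rewrite scale0r add0r mulr0 add0r => H; apply: (is_derive_eq H).
by have sE (a c : R) : a *: c = a * c by []; rewrite !sE; ring.
Qed.

Variables (Om : set 'rV[R]_n) (phi : 'rV[R]_n -> R) (x0 : 'rV[R]_n).
Hypotheses (oOm : open Om) (C2 : C2_on Om phi) (Ox0 : Om x0).

(** On each line through [x0], u - phi has a local maximum. The first-order condition matches the
    gradients; the second-order one bounds the Hessian form of u, written out by the chain rule, by
    that of phi. *)
Lemma radial_contact_max (v : 'rV[R]_n) :
  (\forall x \near x0, u x - phi x <= u x0 - phi x0) ->
  \sum_i v 0 i * partial i phi x0 = 2 * G1 (sqnorm x0) * \sum_i v 0 i * x0 0 i /\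
  2 * sqnorm v * G1 (sqnorm x0) + 4 * (\sum_i v 0 i * x0 0 i) ^+ 2 * G2 (sqnorm x0)
    <= (v *m hessian phi x0 *m v^T) 0 0.
Proof.
move=> umax; have [d1 d2] := C2_on_line v oOm C2 Ox0.
have l0 : 0 *: v + x0 = x0 by rewrite scale0r add0r.
have := @second_order_max _ (fun t : R => u (t *: v + x0) - phi (t *: v + x0))
   (fun t : R => G1 (sqnorm (t *: v + x0)) * (2 * sqnorm v * t + 2 * \sum_i v 0 i * x0 0 i)
     - \sum_i v 0 i * partial i phi (t *: v + x0)) _ _
   (is_deriveB (radial_line2 x0 v) d2).
case.
- near=> t.
  have dphi : is_derive (t : R) 1 (fun t : R => phi (t *: v + x0))
      (\sum_i v 0 i * partial i phi (t *: v + x0)) by near: t.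
  exact: is_deriveB (radial_line x0 v t) dphi.
- by rewrite l0; exact: (@cvg_line _ _ x0 v _ umax).
rewrite /= l0 mulr0 add0r subr_le0 => /eqP; rewrite subr_eq0 => /eqP <- ->.
by split=> //; ring.
Unshelve. all: by end_near. Qed.

Lemma radial_contact_min (v : 'rV[R]_n) :
  (\forall x \near x0, u x - phi x >= u x0 - phi x0) ->
  \sum_i v 0 i * partial i phi x0 = 2 * G1 (sqnorm x0) * \sum_i v 0 i * x0 0 i /\
  (v *m hessian phi x0 *m v^T) 0 0 <=
  2 * sqnorm v * G1 (sqnorm x0) + 4 * (\sum_i v 0 i * x0 0 i) ^+ 2 * G2 (sqnorm x0).
Proof.
move=> umin; have [d1 d2] := C2_on_line v oOm C2 Ox0.
have l0 : 0 *: v + x0 = x0 by rewrite scale0r add0r.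
have := @second_order_min _ (fun t : R => u (t *: v + x0) - phi (t *: v + x0))
   (fun t : R => G1 (sqnorm (t *: v + x0)) * (2 * sqnorm v * t + 2 * \sum_i v 0 i * x0 0 i)
     - \sum_i v 0 i * partial i phi (t *: v + x0)) _ _
   (is_deriveB (radial_line2 x0 v) d2).
case.
- near=> t.
  have dphi : is_derive (t : R) 1 (fun t : R => phi (t *: v + x0))
      (\sum_i v 0 i * partial i phi (t *: v + x0)) by near: t.
  exact: is_deriveB (radial_line x0 v t) dphi.
- by rewrite l0; exact: (@cvg_line _ _ x0 v _ umin).
rewrite /= l0 mulr0 add0r subr_ge0 => /eqP; rewrite subr_eq0 => /eqP <- ->.
by split=> //; ring.
Unshelve. all: by end_near. Qed.

Lemma gradient_radial :
  (forall v : 'rV[R]_n, \sum_i v 0 i * partial i phi x0 =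
     2 * G1 (sqnorm x0) * \sum_i v 0 i * x0 0 i) ->
  gradient phi x0 = (2 * G1 (sqnorm x0)) *: x0.
Proof.
move=> H; apply/rowP => i; rewrite !mxE; have := H (delta_mx 0 i).
have D (F : 'I_n -> R) : \sum_j (delta_mx 0 i : 'rV[R]_n) 0 j * F j = F i.
  rewrite (bigD1 i)//= mxE !eqxx mul1r big1 ?addr0// => j ji.
  by rewrite mxE (negPf ji) andbF mul0r.
by rewrite !D.
Qed.

Hypothesis G1lt0 : forall s : R, 0 <= s -> G1 s < 0.

(** The unit vector [nu] is a multiple l x0, so |nu| = 1 reads l^2 |x0|^2 = 1. Squaring the pairing
    with x0 removes the sign of l. *)
Lemma radial_direction :
  gradient phi x0 = (2 * G1 (sqnorm x0)) *: x0 -> gradient phi x0 != 0 ->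
  let nu := (eucl_norm (gradient phi x0))^-1 *: gradient phi x0 in
  sqnorm nu = 1 /\ (\sum_i nu 0 i * x0 0 i) ^+ 2 = sqnorm x0.
Proof.
move=> gE g0; have nu1 := sqnorm_normalized g0; split=> //.
move: nu1; rewrite {2 4}gE scalerA; set l := _ * _ => nu1.
have -> : \sum_i (l *: x0) 0 i * x0 0 i = l * sqnorm x0.
  by rewrite mulr_sumr; apply: eq_bigr => i _; rewrite mxE expr2 mulrA.
by rewrite exprMn [_ ^+ 2 * _ ^+ 2]mulrA -sqnormZ nu1 mul1r.
Qed.

Lemma radial_critical_point :
  gradient phi x0 = (2 * G1 (sqnorm x0)) *: x0 -> gradient phi x0 = 0 -> x0 = 0.
Proof.
move=> -> /eqP; rewrite scaler_eq0 mulf_eq0 pnatr_eq0 /=.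
by rewrite lt_eqF ?G1lt0 ?sqnorm_ge0//= => /eqP.
Qed.

End RadialFunction.

(** The right-hand side is - g'' for g(r) = G(r^2). Where the gradient of the test function is
    nonzero, the contact inequality is used in its direction; since G' < 0, it vanishes only at the
    origin. *)
Lemma radial_viscosity_solution (R : realType) n (G G1 G2 : R -> R) (Om : set 'rV[R]_n) :
  (0 < n)%N -> open Om ->
  (forall s : R, 0 <= s -> is_derive s 1 G (G1 s)) ->
  (forall s : R, 0 <= s -> is_derive s 1 G1 (G2 s)) ->
  (forall s : R, 0 <= s -> G1 s < 0) ->
  viscosity_solution Om (fun x => G (sqnorm x))
    (fun x => - (2 * G1 (sqnorm x) + 4 * sqnorm x * G2 (sqnorm x))).
Proof.
move=> n0 oOm dG dG1 G1lt0; split.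
- by apply: continuous_subspaceT; exact: continuous_radial dG.
- move=> x0 phi Ox0 C2 umax.
  have contact v := radial_contact_max dG dG1 oOm C2 Ox0 v umax.
  have gE := gradient_radial (fun v => (contact v).1).
  split=> [g0|g0]; rewrite lerN2.
    rewrite /inf_laplacian.
    have [nu1 nux] := radial_direction gE g0.
    have := (contact ((eucl_norm (gradient phi x0))^-1 *: gradient phi x0)).2.
    by rewrite nu1 nux mulr1.
  (* At the origin the mixed term disappears, and the contact inequality compares the Hessian of phi
     with 2 G'(0) times the identity. *)
  have x00 := radial_critical_point G1lt0 gE g0.
  apply: max_eigenvalue_ge => //; first exact: hessian_sym C2 Ox0.
  move=> v; apply: le_trans (contact v).2.
  rewrite x00 [X in 4 * X ^+ 2 * _]big1 => [|i _]; last by rewrite mxE mulr0.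
  have -> : sqnorm (0 : 'rV[R]_n) = 0 by apply/eqP; rewrite sqnorm_eq0.
  by rewrite -[\sum_i _]/(sqnorm v) expr0n /= !(mulr0, mul0r, addr0) mulrAC.
- move=> x0 phi Ox0 C2 umin.
  have contact v := radial_contact_min dG dG1 oOm C2 Ox0 v umin.
  have gE := gradient_radial (fun v => (contact v).1).
  split=> [g0|g0]; rewrite lerN2.
    rewrite /inf_laplacian.
    have [nu1 nux] := radial_direction gE g0.
    have := (contact ((eucl_norm (gradient phi x0))^-1 *: gradient phi x0)).2.
    by rewrite nu1 nux mulr1.
  have x00 := radial_critical_point G1lt0 gE g0.
  apply: min_eigenvalue_le => //; first exact: hessian_sym C2 Ox0.
  move=> v; apply: (le_trans (contact v).2).
  rewrite x00 [X in 4 * X ^+ 2 * _]big1 => [|i _]; last by rewrite mxE mulr0.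
  have -> : sqnorm (0 : 'rV[R]_n) = 0 by apply/eqP; rewrite sqnorm_eq0.
  by rewrite -[\sum_i _]/(sqnorm v) expr0n /= !(mulr0, mul0r, addr0) mulrAC.
Qed.

(** * Averages of smoothed cones *)

(** Meant for A = sqrt (s + a^2) and B = sqrt (s + a^2/4). Convexity of 1/y gives 1/B - 1/A >= (A -
    B)/A^2, while a^2 = 4/3 (A - B)(A + B) is at most 8/3 (A - B) A. *)
Lemma inv_gap_le (R : realFieldType) (A B a : R) :
  0 < A -> 0 < B -> B <= A -> 3 * a ^+ 2 = 4 * (A ^+ 2 - B ^+ 2) ->
  a ^+ 2 * (A ^+ 3)^-1 <= 3 * (B^-1 - A^-1).
Proof.
move=> A0 B0 BA aE.
have A20 : 0 < A ^+ 2 by rewrite exprn_gt0.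
have A30 : 0 < A ^+ 3 by rewrite exprn_gt0.
(* The left side is the tangent to 1/y at A, evaluated at B. *)
have tangent : (2 * A - B) / A ^+ 2 <= B^-1.
  by rewrite ler_pdivrMr// [leRHS]mulrC ler_pdivlMr//; nra.
apply: (@le_trans _ _ (3 * ((2 * A - B) / A ^+ 2 - A^-1))); last by lra.
have -> : 3 * ((2 * A - B) / A ^+ 2 - A^-1) = 3 * (A - B) * A * (A ^+ 3)^-1.
  by field; rewrite gt_eqF.
by rewrite ler_pM2r ?invr_gt0//; nra.
Qed.

Section SmoothedCones.
Variable R : realType.
Implicit Types (c s : R) (k : nat).

Definition dyadic (j : nat) : R := 2 ^- j.

Lemma dyadic_gt0 j : 0 < dyadic j.
Proof. by rewrite invr_gt0 exprn_gt0. Qed.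

Lemma dyadicS j : dyadic j = 2 * dyadic j.+1.
Proof. by rewrite /dyadic exprS invfM mulVKf. Qed.

Let radius (s c : R) := Num.sqrt (s + c ^+ 2).

Let radius_gt0 s c : 0 <= s -> 0 < c -> 0 < radius s c.
Proof. by move=> s0 c0; rewrite sqrtr_gt0 ltr_wpDl// exprn_gt0. Qed.

Let is_derive_radius s c : 0 <= s -> 0 < c ->
  is_derive s 1 (radius^~ c) (2 * radius s c)^-1.
Proof.
move=> s0 c0.
have dshift : is_derive s 1 (fun r : R => r + c ^+ 2) 1.
  by apply: is_derive_eq; rewrite addr0.
have := @is_derive1_comp _ Num.sqrt (fun r : R => r + c ^+ 2) s _ _ _ dshift.
move=> /(_ (2 * radius s c)^-1); rewrite mulr1; apply.
by apply: is_derive1_sqrt; rewrite ltr_wpDl// exprn_gt0.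
Qed.

Let is_derive_radiusV s c : 0 <= s -> 0 < c ->
  is_derive s 1 (fun r => (2 * radius r c)^-1) (- (4 * radius s c ^+ 3)^-1).
Proof.
move=> s0 c0; have r0 := radius_gt0 s0 c0.
have d2 : is_derive s 1 (fun r => 2 * radius r c) (2 * (2 * radius s c)^-1).
  exact: (is_deriveZ 2 (is_derive_radius s0 c0)).
have nz : 2 * radius s c != 0 by rewrite mulf_neq0// gt_eqF.
have d3 := @is_deriveV R (fun r => 2 * radius r c) s _ 1 nz d2.
apply: (@is_derive_eq _ _ _ (fun r => (2 * radius r c)^-1) s 1 _ _ d3).
have sE (a b : R) : a *: b = a * b by [].
by rewrite sE; field; rewrite gt_eqF.
Qed.

(* The average of the smoothed cones sqrt (|x|^2 + 4^-j) over the dyadic scales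
   j <= k, as a function of s = |x|^2. *)
Definition cones k s : R :=
  k.+1%:R^-1 * \sum_(j < k.+1) (radius 1 (dyadic j) - radius s (dyadic j)).
Let cones1 k s : R := - (k.+1%:R^-1 * \sum_(j < k.+1) (2 * radius s (dyadic j))^-1).
Let cones2 k s : R := k.+1%:R^-1 * \sum_(j < k.+1) (4 * radius s (dyadic j) ^+ 3)^-1.

Definition cones_source k s : R :=
  k.+1%:R^-1 * \sum_(j < k.+1) dyadic j ^+ 2 * (radius s (dyadic j) ^+ 3)^-1.

Lemma cones_sourceE k s : 0 <= s ->
  cones_source k s = - (2 * cones1 k s + 4 * s * cones2 k s).
Proof.
move=> s0; rewrite /cones1 /cones2 mulrN opprD opprK.
rewrite mulrCA [4 * s * _]mulrCA -mulrBr !mulr_sumr -sumrB; congr (_ * _).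
apply: eq_bigr => j _; have r0 := radius_gt0 s0 (dyadic_gt0 j).
(* Eliminating the scale turns the claim into a rational identity in the radius and s. *)
have -> : dyadic j ^+ 2 = radius s (dyadic j) ^+ 2 - s.
  by rewrite sqr_sqrtr ?addr_ge0 ?sqr_ge0// addrC addKr.
by field; rewrite gt_eqF.
Qed.

Lemma is_derive_cones k s : 0 <= s -> is_derive s 1 (cones k) (cones1 k s).
Proof.
move=> s0; rewrite /cones1 -mulrN -sumrN.
have -> : cones k = k.+1%:R^-1 *: \sum_(j < k.+1)
    (fun s => radius 1 (dyadic j) - radius s (dyadic j)).
  by apply/funext => r; rewrite /cones [in RHS]fctE fct_sumE.
apply: is_deriveZ; apply: is_derive_sum => j.
rewrite -[- _]add0r.
exact: (is_deriveB (is_derive_cst _ _ _) (is_derive_radius s0 (dyadic_gt0 j))).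
Qed.

Lemma is_derive_cones1 k s : 0 <= s -> is_derive s 1 (cones1 k) (cones2 k s).
Proof.
move=> s0.
have -> : cones1 k = (- k.+1%:R^-1) *: \sum_(j < k.+1)
    (fun s => (2 * radius s (dyadic j))^-1).
  by apply/funext => r; rewrite /cones1 [in RHS]fctE fct_sumE -mulNr.
have -> : cones2 k s = (- k.+1%:R^-1) *: \sum_(j < k.+1)
    (- (4 * radius s (dyadic j) ^+ 3)^-1).
  by rewrite sumrN scalerN scaleNr opprK.
apply: is_deriveZ; apply: is_derive_sum => j.
exact: is_derive_radiusV s0 (dyadic_gt0 j).
Qed.

Lemma cones1_lt0 k s : 0 <= s -> cones1 k s < 0.
Proof.
move=> s0; rewrite oppr_lt0 mulr_gt0 ?invr_gt0 ?ltr0n// big_ord_recl.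
rewrite ltr_pwDl ?sumr_ge0// => [|j _].
  by rewrite invr_gt0 mulr_gt0 ?radius_gt0 ?dyadic_gt0.
by rewrite invr_ge0 mulr_ge0// sqrtr_ge0.
Qed.

Lemma cones_viscosity_solution n k (Om : set 'rV[R]_n) : (0 < n)%N -> open Om ->
  viscosity_solution Om (fun x => cones k (sqnorm x)) (fun x => cones_source k (sqnorm x)).
Proof.
move=> n0 oOm.
have -> : (fun x : 'rV[R]_n => cones_source k (sqnorm x)) =
   (fun x => - (2 * cones1 k (sqnorm x) + 4 * sqnorm x * cones2 k (sqnorm x))).
  by apply/funext => x; rewrite cones_sourceE// sqnorm_ge0.
apply: (@radial_viscosity_solution _ _ (cones k) (cones1 k) (cones2 k) _ n0 oOm).
- by move=> r; exact: is_derive_cones.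
- exact: is_derive_cones1.
- exact: cones1_lt0.
Qed.

Lemma continuous_cones n k : continuous (fun x : 'rV[R]_n => cones k (sqnorm x)).
Proof. exact: continuous_radial (@is_derive_cones k). Qed.

Lemma cones_le k s t : s <= t -> cones k t <= cones k s.
Proof.
move=> st; rewrite ler_wpM2l ?invr_ge0//; apply: ler_sum => j _.
by rewrite lerD2l lerN2 ler_wsqrtr// lerD2r.
Qed.

Lemma cones_1 k : cones k 1 = 0.
Proof. by rewrite /cones big1 ?mulr0// => j _; rewrite subrr. Qed.

Lemma sum_dyadic_lt2 k : \sum_(j < k) dyadic j < 2.
Proof.
suff -> : \sum_(j < k) dyadic j = 2 - 2 * dyadic k.
  by rewrite ltrBlDr ltrDl mulr_gt0 ?dyadic_gt0.
elim: k => [|k IH]; first by rewrite big_ord0 /dyadic expr0 invr1 mulr1 subrr.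
by rewrite big_ord_recr /= IH (dyadicS k); ring.
Qed.

Lemma radius_gap_le k s : 0 <= s ->
  dyadic k ^+ 2 * (radius s (dyadic k) ^+ 3)^-1 <=
  3 * ((radius s (dyadic k.+1))^-1 - (radius s (dyadic k))^-1).
Proof.
move=> s0; have a0 := dyadic_gt0 k.+1.
have A0 := radius_gt0 s0 (dyadic_gt0 k); have B0 := radius_gt0 s0 a0.
have A2 : radius s (dyadic k) ^+ 2 = s + dyadic k ^+ 2.
  by rewrite sqr_sqrtr// addr_ge0// sqr_ge0.
have B2 : radius s (dyadic k.+1) ^+ 2 = s + dyadic k.+1 ^+ 2.
  by rewrite sqr_sqrtr// addr_ge0// sqr_ge0.
have BA : radius s (dyadic k.+1) <= radius s (dyadic k).
  by rewrite -ler_sqr ?nnegrE ?ltW// A2 B2 (dyadicS k); nra.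
have aE : 3 * dyadic k ^+ 2 = 4 * (radius s (dyadic k) ^+ 2 - radius s (dyadic k.+1) ^+ 2).
  by rewrite A2 B2 (dyadicS k); ring.
exact: inv_gap_le A0 B0 BA aE.
Qed.

(** Each summand is at most 3 times the gap between consecutive inverse radii. The gaps telescope;
    the outermost inverse radius is dropped and the innermost remains, at scale 2^-(k+1). *)
Lemma cones_source_le k s : 0 <= s ->
  cones_source k s <= 3 / k.+1%:R * (Num.sqrt (s + dyadic k.+1 ^+ 2))^-1.
Proof.
move=> s0; rewrite [3 / _]mulrC -mulrA ler_wpM2l ?invr_ge0//.
apply: (@le_trans _ _ (\sum_(j < k.+1)
    3 * ((radius s (dyadic j.+1))^-1 - (radius s (dyadic j))^-1))).
  by apply: ler_sum => j _; exact: radius_gap_le.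
rewrite -mulr_sumr ler_wpM2l//.
rewrite -(big_mkord xpredT (fun j => (radius s (dyadic j.+1))^-1 - (radius s (dyadic j))^-1)).
rewrite telescope_sumr// lerBlDr lerDl invr_ge0 sqrtr_ge0//.
Qed.

Lemma cones_source_ge0 k s : 0 <= cones_source k s.
Proof.
rewrite mulr_ge0 ?invr_ge0// sumr_ge0// => j _.
by rewrite mulr_ge0 ?sqr_ge0// invr_ge0 exprn_ge0// sqrtr_ge0.
Qed.

Lemma continuous_cones_source k s : 0 <= s -> {for s, continuous (cones_source k)}.
Proof.
move=> s0; apply/differentiable_continuous/derivable1_diffP.
have -> : cones_source k = k.+1%:R^-1 *: \sum_(j < k.+1)
    (dyadic j ^+ 2 *: (fun s => (radius s (dyadic j) ^+ 3)^-1)).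
  by apply/funext => r; rewrite /cones_source [in RHS]fctE fct_sumE.
apply: derivableZ; apply: derivable_sum => j; apply: derivableZ.
apply: derivableV; first by rewrite expf_neq0// gt_eqF// radius_gt0// dyadic_gt0.
have [d _] := is_derive_radius s0 (dyadic_gt0 j).
by have := @derivableX _ _ _ 3 _ _ d; rewrite exprfctE.
Qed.

(** Each term sqrt (1 + a^2) - a lies between 1 - a and 1, and the scales a = 2^-j sum to less than
    2. *)
Lemma cones_0_bounds k : 1 - 2 / k.+1%:R <= cones k 0 <= 1.
Proof.
have K0 : 0 < k.+1%:R :> R by rewrite ltr0n.
have term j : 1 - dyadic j <= radius 1 (dyadic j) - radius 0 (dyadic j) <= 1.
  have a0 := dyadic_gt0 j.
  rewrite /radius add0r sqrtr_sqr gtr0_norm// lerD2r lerBlDr; apply/andP; split.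
    by rewrite -{1}[1]sqrtr1 ler_wsqrtr// lerDl sqr_ge0.
  rewrite -[leRHS]ger0_norm -?sqrtr_sqr ?ler_wsqrtr//; last by lra.
  by nra.
have sum1 : \sum_(j < k.+1) (1 : R) = k.+1%:R by rewrite sumr_const card_ord.
apply/andP; split.
  rewrite /cones ler_pdivlMl// mulrBr mulr1 mulrCA mulfV ?gt_eqF// mulr1.
  apply: (@le_trans _ _ (\sum_(j < k.+1) (1 - dyadic j))).
    by rewrite sumrB sum1 lerD2l lerN2 ltW// sum_dyadic_lt2.
  by apply: ler_sum => j _; have /andP[] := term j.
rewrite /cones ler_pdivrMl// mulr1 -sum1.
by apply: ler_sum => j _; have /andP[] := term j.
Qed.

End SmoothedCones.

(** * The L^n norm of the source *)

Section CubeMeasure.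
Variable R : realType.
Local Notation mR := (measurableTypeR R).

(** Cubes replace balls because they are products of intervals, so their measure follows by
    induction on the dimension. *)
Definition cube (n : nat) (r : R) : set (n.-tuple mR) :=
  [set t | forall i, `|tnth t i| <= r].

Arguments cube n r t : clear implicits.

Lemma measurable_cube n r : measurable (cube n r).
Proof.
have -> : cube n r = \bigcap_(i in [set: 'I_n]) [set t : n.-tuple mR | tnth t i \in `[- r, r]].
  apply/seteqP; split => t /= tr i.
    by move=> _ /=; rewrite in_itv/= -ler_norml; exact: tr.
  by have := tr i I; rewrite /= in_itv/= -ler_norml.
apply: fin_bigcap_measurable => // i _.
have := @measurable_tnth _ mR n i measurableT _ (measurable_itv `[- r, r]).
by rewrite setTI.
Qed.

Lemma lebesgue_tuple_cube n (r : R) : 0 < r ->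
  lebesgue_tuple n (cube n r) = ((2 * r) ^+ n)%:E.
Proof.
move=> r0; elim: n => [|n IH].
  by rewrite /= diracE expr0 mem_set// => -[].
rewrite /= /pushforward.
have -> : @tuple_cons R n @^-1` cube n.+1 r = [set` `[- r, r]] `*` cube n r.
  apply/seteqP; split => -[x t] /=.
    move=> xt; split.
      by have := xt ord0; rewrite (tnth_nth x)/= in_itv/= ler_norml.
    by move=> i; have := xt (lift ord0 i); rewrite !(tnth_nth x).
  move=> [xr tr] i; rewrite (tnth_nth x); case: (unliftP ord0 i) => [j ->|->] /=.
    by have := tr j; rewrite (tnth_nth x).
  by move: xr; rewrite in_itv/= ler_norml.
rewrite product_measure1E//; last exact: measurable_cube.
rewrite [X in (_ * X)%E]IH [X in (X * _)%E]lebesgue_measure_itv /= lte_fin gtrN//.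
by rewrite -EFinB -EFinM exprS opprK -mulr2n mulr_natl.
Qed.

End CubeMeasure.
Arguments cube {R} n r t.

(** Take the smallest of the cubes of index at most [K] that contains [t]. Either it has index [K],
    and the offset under the root suffices, or [t] leaves the next cube, and one coordinate exceeds
    2^-(j+1). *)
Lemma dyadic_shell (R : realType) n (K : nat) (t : n.-tuple R) :
  cube n (dyadic R 0) t ->
  exists2 j, (j < K.+1)%N & cube n (dyadic R j) t /\
    dyadic R j.+1 <= Num.sqrt (sqnorm (row_of_tuple t) + dyadic R K ^+ 2).
Proof.
move=> t1.
have [j jK [tj jmax]] : exists2 j, (j < K.+1)%N &
    cube n (dyadic R j) t /\ (j = K \/ ~ cube n (dyadic R j.+1) t).
  elim: K => [|K [j jK [tj [jE|jmax]]]]; first by exists 0%N => //; split=> //; left.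
  - have [tjS|tjS] := pselect (cube n (dyadic R K.+1) t).
      by exists K.+1 => //; split=> //; left.
    by exists j; [exact: ltnW|split=> //; right; rewrite jE].
  - by exists j; [exact: ltnW|split=> //; right].
exists j => //; split=> //.
rewrite -[leLHS](gtr0_norm (dyadic_gt0 R j.+1)) -sqrtr_sqr ler_wsqrtr//.
case: jmax => [->|/existsNP[i /negP]].
  apply: ler_wpDl; first exact: sqnorm_ge0.
  have dK := dyadic_gt0 R K.+1; have dKS := dyadicS R K.
  by apply: lerXn2r; rewrite ?nnegrE; lra.
rewrite -ltNge => ti; apply: ler_wpDr; first exact: sqr_ge0.
rewrite /sqnorm (bigD1 i)//= mxE; apply: ler_wpDr.
  by apply: sumr_ge0 => l _; exact: sqr_ge0.
rewrite -[tnth t i ^+ 2]real_normK ?num_real//.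
by apply: lerXn2r; rewrite ?nnegrE//; [exact/ltW/dyadic_gt0|exact: ltW].
Qed.

Section SourceNorm.
Variables (R : realType) (n k : nat).
Local Notation mR := (measurableTypeR R).
Local Notation K := (k.+1%:R : R).
Let F : R -> R := cones_source k.

(** The bound 3/K times the inverse root is at most 3/K 2^(j+1) on the shell of [t]. Summing over
    all cubes instead of disjoint shells only adds nonnegative terms. *)
Lemma cones_source_shell_le (t : n.-tuple R) : sqnorm (row_of_tuple t) < 1 ->
  F (sqnorm (row_of_tuple t)) ^+ n <=
    \sum_(j < k.+2) (3 / K * 2 ^+ j.+1) ^+ n * \1_(cube n (dyadic R j)) t.
Proof.
move=> t1.
have cube0 : cube n (dyadic R 0) t.
  move=> i; rewrite /dyadic expr0 invr1 -sqrtr_sqr -[leRHS]sqrtr1 ler_wsqrtr//.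
  apply: le_trans (ltW t1); rewrite /sqnorm (bigD1 i)//= mxE lerDl.
  by apply: sumr_ge0 => l _; exact: sqr_ge0.
have [j jK [tj jS]] := dyadic_shell k.+1 cube0.
rewrite (bigD1 (Ordinal jK))//= indicE mem_set// mulr1.
apply: ler_wpDr.
  by apply: sumr_ge0 => i _; rewrite mulr_ge0// exprn_ge0// mulr_ge0 ?exprn_ge0.
apply: lerXn2r; rewrite ?nnegrE ?cones_source_ge0//.
apply: (le_trans (cones_source_le _ (sqnorm_ge0 _))).
rewrite ler_wpM2l ?divr_ge0// -[leRHS]invrK lef_pV2 ?posrE//.
by rewrite (lt_le_trans _ jS)// dyadic_gt0.
Qed.

(** By scaling, every cube contributes the same amount: (3/K 2^(j+1))^n times the volume (2 2^-j)^n
    is (12/K)^n. *)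
Lemma integral_shells :
  (\int[lebesgue_tuple n]_t (\sum_(j < k.+2)
     ((3 / K * 2 ^+ j.+1) ^+ n)%:E * (\1_(cube n (dyadic R j)) t)%:E) =
   (k.+2%:R * (12 / K) ^+ n)%:E)%E.
Proof.
have K0 : K != 0 by rewrite pnatr_eq0.
have c0 (j : nat) : 0 <= (3 / K * 2 ^+ j.+1) ^+ n.
  by rewrite exprn_ge0// mulr_ge0 ?exprn_ge0// divr_ge0.
have mI j : measurable_fun [set: n.-tuple mR]
    (fun t => (\1_(cube n (dyadic R j)) t : R)%:E).
  by apply/measurable_EFinP; apply: measurable_indic; exact: measurable_cube.
have mcI (j : 'I_k.+2) : measurable_fun [set: n.-tuple mR]
    (fun t => ((3 / K * 2 ^+ j.+1) ^+ n)%:E * (\1_(cube n (dyadic R j)) t)%:E)%E.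
  by apply: measurable_funeM; exact: mI.
rewrite (ge0_integral_sum _ measurableT mcI); last first.
  by move=> j t _; rewrite -EFinM lee_fin mulr_ge0// indicE.
transitivity (\sum_(j < k.+2) ((12 / K) ^+ n)%:E)%E; last first.
  by rewrite sumEFin sumr_const card_ord [in RHS]mulr_natl.
apply: eq_bigr => j _; rewrite (ge0_integralZl _ measurableT (mI j)); last 2 first.
- by move=> t _; rewrite lee_fin indicE.
- by rewrite lee_fin.
rewrite integral_indic//; last exact: measurable_cube.
rewrite setIT [X in (_ * X)%E](lebesgue_tuple_cube n (dyadic_gt0 R j)) -EFinM -exprMn; congr (_ ^+ _)%:E.
have e0 : 2 ^+ j != 0 :> R by rewrite expf_neq0.
rewrite /dyadic exprS; move: (2 ^+ j) e0 K K0 => e e0 x x0.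
by field; rewrite x0 e0.
Qed.

Lemma measurable_sqnorm_tuple :
  measurable_fun setT (fun t : n.-tuple mR => sqnorm (row_of_tuple t) : mR).
Proof.
have -> : (fun t : n.-tuple mR => sqnorm (row_of_tuple t) : mR) =
    (fun t => \sum_(i < n) (tnth t i) ^+ 2).
  by apply/funext => t; apply: eq_bigr => i _; rewrite mxE.
by apply: measurable_sum => i; apply: measurable_funX; exact: measurable_tnth.
Qed.

Lemma Lp_norm_cones_source_le : (2 <= n)%N ->
  (Lp_norm n%:R (unit_ball R n) (fun x => F (sqnorm x)) <=
   ((2 * 12 ^+ n / K) `^ n%:R^-1)%:E)%E.
Proof.
move=> n2; have n0 : 0 < n%:R :> R by rewrite ltr0n (leq_trans _ n2).
have K0 : 0 < K by rewrite ltr0n.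
(* The integrand of the norm. The absolute value changes nothing at squared norms but makes the
   source continuous on all of R, hence measurable. *)
pose H (t : n.-tuple mR) : R :=
  if sqnorm (row_of_tuple t) < 1 then F `|sqnorm (row_of_tuple t)| ^+ n else 0.
have H0 t : 0 <= H t.
  by rewrite /H; case: ifP => // _; rewrite exprn_ge0// cones_source_ge0.
have mH : measurable_fun setT H.
  apply: measurable_fun_ifT => //.
    by apply: measurable_fun_ltr => //; exact: measurable_sqnorm_tuple.
  apply: measurable_funX.
  apply: (@measurableT_comp _ _ _ _ _ _ (fun s : R => F `|s|)); last exact: measurable_sqnorm_tuple.
  apply: continuous_measurable_fun => s.
  apply: (@continuous_comp _ _ _ (fun r : R => `|r|) F).
    by apply: (@cvg_norm _ R^o); exact: cvg_id.
  by apply: continuous_cones_source; exact: normr_ge0.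
rewrite /Lp_norm unlock -poweR_EFin.
apply: gt0_ler_poweR.
- by rewrite invr_ge0 ltW.
- by rewrite in_itv/= leey andbT integral_ge0// => t _; exact: poweR_ge0.
- by rewrite in_itv/= leey andbT lee_fin !mulr_ge0 ?exprn_ge0// invr_ge0 ltW.
rewrite (_ : (\int[_]_x _)%E = (\int[lebesgue_tuple n]_t (H t)%:E)%E); last first.
  apply: eq_integral => t _ /=; rewrite patchE.
  have -> : (row_of_tuple t \in unit_ball R n) = (sqnorm (row_of_tuple t) < 1).
    rewrite -eucl_norm_sqr expr_lt1 ?sqrtr_ge0//.
    by apply/idP/idP; rewrite inE.
  rewrite /H; case: ifP => _; rewrite powR_mulrn ?normr_ge0//.
    by rewrite !ger0_norm ?cones_source_ge0 ?sqnorm_ge0.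
  (* Outside the ball the restriction takes the default value [point], which is 0 in R; its n-th
     power is 0 because n is positive. *)
  by rewrite [point]/(0 : R) normr0 expr0n; case: (n) n2.
apply: (@le_trans _ _ (k.+2%:R * (12 / K) ^+ n)%:E).
  rewrite -integral_shells; apply: ge0_le_integral => //.
  - by move=> t _; rewrite lee_fin.
  - exact/measurable_EFinP.
  - apply: emeasurable_sum => j; apply: measurable_funeM.
    by apply/measurable_EFinP; apply: measurable_indic; exact: measurable_cube.
  move=> t _; under eq_bigr do rewrite -EFinM.
  rewrite sumEFin lee_fin /H; case: ifP => [t1|_].
    by rewrite ger0_norm ?sqnorm_ge0//; exact: cones_source_shell_le.
  by apply: sumr_ge0 => j _; rewrite mulr_ge0// exprn_ge0// mulr_ge0 ?exprn_ge0// divr_ge0.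
rewrite lee_fin expr_div_n mulrCA [2 * _]mulrC -[leRHS]mulrA ler_wpM2l ?exprn_ge0//.
(* Factor by factor, k + 2 <= 2 K and K^-n <= K^-2; the latter is where n >= 2 enters. *)
have -> : 2 / K = 2 * K * (K ^+ 2)^-1 by field; rewrite gt_eqF.
apply: ler_pM => //; first by rewrite -natrM ler_nat mul2n -addnn addSn ltnS addnS ltnS leq_addr.
by rewrite lef_pV2 ?posrE ?exprn_gt0// ler_weXn2l// ler1n.
Qed.

End SourceNorm.

(** * Failure of the ABP estimate *)

(** The profile decreases in |x|^2, so the supremum is attained at the center. *)
Lemma sup_cones (R : realType) n k :
  sup ((fun x : 'rV[R]_n => cones k (sqnorm x)) @` unit_ball R n) = cones k 0.
Proof.
have sq0 : sqnorm (0 : 'rV[R]_n) = 0 by apply/eqP; rewrite sqnorm_eq0.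
have ub0 : ubound ((fun x : 'rV[R]_n => cones k (sqnorm x)) @` unit_ball R n) (cones k 0).
  by move=> _ [x _ <-]; apply: cones_le; exact: sqnorm_ge0.
have in0 : ((fun x : 'rV[R]_n => cones k (sqnorm x)) @` unit_ball R n) (cones k 0).
  exists 0; last by rewrite sq0.
  by rewrite /unit_ball /= /eucl_norm -/(sqnorm (0 : 'rV[R]_n)) sq0 sqrtr0.
apply/eqP; rewrite eq_le; apply/andP; split.
  by apply: ge_sup => //; exists (cones k 0).
by apply: ub_le_sup => //; exists (cones k 0).
Qed.

Lemma cvg_cones_0 (R : realType) : cones k (0 : R) @[k --> \oo] --> (1 : R).
Proof.
apply: (@squeeze_cvgr _ _ _ _ (fun k => 1 - 2 * harmonic k) (fun=> 1)).
- by near=> k; exact: cones_0_bounds.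
- rewrite -[X in _ --> X]subr0 -[X in _ - X](mulr0 2).
  by apply: cvgB; [exact: cvg_cst|apply: cvgMl_tmp; exact: cvg_harmonic].
- exact: cvg_cst.
Unshelve. all: by end_near. Qed.

Lemma cvg_powR_harmonic (R : realType) (n : nat) (c : R) : (0 < n)%N -> 0 < c ->
  (c / k.+1%:R) `^ n%:R^-1 @[k --> \oo] --> (0 : R).
Proof.
move=> n0 c0; apply/cvgrPdist_le => e e0.
have en0 : 0 < e ^+ n / c by rewrite divr_gt0// exprn_gt0.
near=> k.
have ke : k.+1%:R^-1 < e ^+ n / c.
  by near: k; exact: (near_infty_natSinv_lt (PosNum en0)).
have c_ge0 : 0 <= c / k.+1%:R by rewrite divr_ge0// ltW.
rewrite sub0r normrN ger0_norm ?powR_ge0//.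
have -> : e = (e ^+ n) `^ n%:R^-1.
  by rewrite -powR_mulrn ?ltW// -powRrM mulfV ?powRr1 ?ltW// pnatr_eq0 -lt0n.
apply: ge0_ler_powR; rewrite ?nnegrE ?invr_ge0//; first by rewrite exprn_ge0// ltW.
by rewrite ltW// [ltLHS]mulrC -ltr_pdivlMr.
Unshelve. all: by end_near. Qed.

Lemma cvg_Lp_norm_cones_source (R : realType) n : (2 <= n)%N ->
  Lp_norm n%:R (unit_ball R n) (fun x => cones_source k (sqnorm x)) @[k --> \oo] --> 0%E.
Proof.
move=> n2.
apply: (@squeeze_cvge _ _ _ _ (fun=> 0%E) _
  (fun k => ((2 * 12 ^+ n / k.+1%:R) `^ n%:R^-1)%:E)).
- by near=> k; rewrite Lp_norm_cones_source_le// andbT; exact: Lnorm_ge0.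
- exact: cvg_cst.
- apply: cvg_EFin; first by near=> k.
  by apply: cvg_powR_harmonic; [exact: ltnW|rewrite mulr_gt0 ?exprn_gt0].
Unshelve. all: by end_near. Qed.

Theorem mainTheorem2 (R : realType) (n : nat) (hn : (2 <= n)%N) :
  (exists u f : nat -> 'rV[R]_n -> R,
    (forall k,
      [/\ {within unit_cball R n, continuous (u k)},
          {within unit_ball R n, continuous (f k)},
          viscosity_solution (unit_ball R n) (u k) (f k)
        & forall x, unit_sphere R n x -> u k x = 0]) /\
    (sup (u k @` unit_ball R n) @[k --> \oo] --> (1 : R)) /\
    (Lp_norm n%:R (unit_ball R n) (f k) @[k --> \oo] --> 0%E)) /\
  ~ (exists C : R, forall u f : 'rV[R]_n -> R,
      {within unit_cball R n, continuous u} ->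
      {within unit_ball R n, continuous f} ->
      viscosity_solution (unit_ball R n) u f ->
      ((sup (u @` unit_ball R n))%:E <=
       (sup (u @` unit_sphere R n))%:E +
       C%:E * Lp_norm n%:R (unit_ball R n) f)%E).
Proof.
have n0 : (0 < n)%N by exact: ltnW.
pose u k (x : 'rV[R]_n) := cones k (sqnorm x).
pose f k (x : 'rV[R]_n) := cones_source k (sqnorm x).
have cu k : {within unit_cball R n, continuous (u k)}.
  by apply: continuous_subspaceT; exact: continuous_cones.
have cf k : {within unit_ball R n, continuous (f k)}.
  apply: continuous_subspaceT => x.
  apply: (@continuous_comp _ _ _ (@sqnorm R n) (cones_source k)).
    exact: continuous_sqnorm.
  exact/continuous_cones_source/sqnorm_ge0.
have uf k : viscosity_solution (unit_ball R n) (u k) (f k).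
  by apply: cones_viscosity_solution => //; exact: open_unit_ball.
have u0 k x : unit_sphere R n x -> u k x = 0.
  by move=> x1; rewrite /u -eucl_norm_sqr x1 expr1n cones_1.
have supu : sup (u k @` unit_ball R n) @[k --> \oo] --> (1 : R).
  by under eq_fun do rewrite sup_cones; exact: cvg_cones_0.
have Lf : Lp_norm n%:R (unit_ball R n) (f k) @[k --> \oo] --> 0%E.
  exact: cvg_Lp_norm_cones_source.
split.
  exists u, f; split=> [k|]; last by split.
  by split=> // x; exact: u0.
move=> [C HC].
(* The image of the sphere is the singleton {0}; a coordinate vector witnesses that the sphere is
   nonempty. *)
have supS k : sup (u k @` unit_sphere R n) = 0.
  rewrite -[RHS]sup1; congr sup; apply/seteqP; split => [_ [x x1 <-]|_ ->].
    exact: u0 x1.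
  have e1 : unit_sphere R n (delta_mx 0 (Ordinal n0)).
    rewrite /unit_sphere /= /eucl_norm (bigD1 (Ordinal n0))//= big1 => [|i i0].
      by rewrite mxE !eqxx expr1n addr0 sqrtr1.
    by rewrite mxE (negPf i0) andbF expr0n.
  by exists (delta_mx 0 (Ordinal n0)); [exact: e1|exact: u0].
(* The supposed estimate for u_k and f_k, passed to the limit in k. *)
have : (1%:E <= C%:E * 0 :> \bar R)%E.
  have cC : (C%:E * Lp_norm n%:R (unit_ball R n) (f k))%E @[k --> \oo] --> (C%:E * 0)%E.
    by apply: cvgeZl.
  have c1 : (sup (u k @` unit_ball R n))%:E @[k --> \oo] --> (1%:E : \bar R).
    by apply: cvg_EFin => //; near=> k.
  rewrite -(cvg_lim _ cC)// -(cvg_lim _ c1)//.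
  apply: lee_lim; [by apply/cvg_ex; eexists; exact: c1|by apply/cvg_ex; eexists; exact: cC|].
  by near=> k; have := HC _ _ (cu k) (cf k) (uf k); rewrite supS add0e.
by rewrite mule0 lee_fin ler10.
Unshelve. all: by end_near. Qed.
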